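(* Let $k$ be a field of characteristic zero, $A=k[x_1,\dots,x_n]$, $m\in\{1,\dots,n\}$, and let $f_1,\dots,f_m\in A$ be algebraically independent over $k$. Put $R=k[f_1,\dots,f_m]$. The following are equivalent: (i) $\mathrm{dgcd}(f_1,\dots,f_m)\in k\setminus\{0\}$; (ii) $\operatorname{Irr}R\subset\operatorname{Sqf}A$, i.e. for every irreducible $w\in k[x_1,\dots,x_m]$ the polynomial $w(f_1,\dots,f_m)$ is square-free in $A$; (iii) $\operatorname{Sqf}R\subset\operatorname{Sqf}A$, i.e. for every square-free $w\in k[x_1,\dots,x_m]$ the polynomial $w(f_1,\dots,f_m)$ is square-free in $A$.
   Context: For $f_1,\dots,f_m\in k[x_1,\dots,x_n]$ ($m\le n$), $\mathrm{dgcd}(f_1,\dots,f_m)=\gcd\big(\det(\partial f_a/\partial x_{i_b})_{a,b=1}^m : 1\le i_1<\dots<i_m\le n\big)$, defined up to a nonzero constant factor. For a commutative ring $R$, $\operatorname{Irr}R$ is the set of irreducible elements of $R$ and $\operatorname{Sqf}R$ the set of square-free elements, where $a\in R$ is square-free if it cannot be written as $a=b^2c$ with $b,c\in R$ and $b$ not a unit of $R$. *)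

(* Defs.v *)
(* Multivariate polynomials k[x_1,...,x_n] are encoded as
   iterated univariate polynomials: mpoly R 0 = R, mpoly R n.+1 = {poly mpoly R n}.
   Variable x_{i+1} (0-based index i) of mpoly R n is the 'X of the (i+1)-th level. *)
From HB Require Import structures.
From mathcomp Require Import all_boot all_order all_algebra.
Set Implicit Arguments. Unset Strict Implicit. Unset Printing Implicit Defensive.
Import Order.TTheory GRing.Theory Num.Theory.
Local Open Scope ring_scope.

Fixpoint mpoly (R : idomainType) (n : nat) : idomainType :=
  match n with
  | 0 => R
  | n.+1 => ({poly mpoly R n} : idomainType)
  end.

Fixpoint mconst (R : idomainType) (n : nat) : R -> mpoly R n :=
  match n return R -> mpoly R n with
  | 0 => fun c => c
  | n.+1 => fun c => (@mconst R n c)%:P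
  end.

(* the variable with 0-based index i (meaningful for i < n) *)
Fixpoint mvar (R : idomainType) (n : nat) (i : nat) : mpoly R n :=
  match n return mpoly R n with
  | 0 => 0
  | n.+1 => if i == n then ('X : {poly mpoly R n}) else (@mvar R n i)%:P
  end.

Fixpoint mderiv (R : idomainType) (n : nat) (i : nat) : mpoly R n -> mpoly R n :=
  match n return mpoly R n -> mpoly R n with
  | 0 => fun _ => 0
  | n.+1 => fun p : {poly mpoly R n} =>
      if i == n then deriv p else map_poly (@mderiv R n i) p
  end.

Fixpoint msubst (R : idomainType) (n m : nat) : mpoly R m -> ('I_m -> mpoly R n) -> mpoly R n :=
  match m return mpoly R m -> ('I_m -> mpoly R n) -> mpoly R n with
  | 0 => fun w _ => @mconst R n w
  | m.+1 => fun (w : {poly mpoly R m}) f =>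
      \sum_(j < size w) @msubst R n m w`_j (fun a => f (widen_ord (leqnSn m) a))
                          * f ord_max ^+ j
  end.

Definition alg_indep (R : idomainType) (n m : nat) (f : 'I_m -> mpoly R n) : Prop :=
  forall w : mpoly R m, msubst w f = 0 -> w = 0.

Definition dvdr (A : comRingType) (a b : A) : Prop := exists c, b = c * a.

Definition irreducibler (A : comUnitRingType) (a : A) : Prop :=
  a != 0 /\ a \isn't a GRing.unit /\
  forall b c : A, a = b * c -> b \is a GRing.unit \/ c \is a GRing.unit.

Definition squarefreer (A : comUnitRingType) (a : A) : Prop :=
  ~ exists b c : A, a = b ^+ 2 * c /\ b \isn't a GRing.unit.

Definition is_gcd (A : comRingType) (I : Type) (P : I -> Prop) (F : I -> A) (g : A) : Prop :=
  (forall i, P i -> dvdr g (F i)) /\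
  (forall d, (forall i, P i -> dvdr d (F i)) -> dvdr d g).

Definition incr_idx (m n : nat) (s : 'I_m -> 'I_n) : Prop :=
  forall a b : 'I_m, (a < b)%N -> (s a < s b)%N.

Definition jac_minor (R : idomainType) (n m : nat) (f : 'I_m -> mpoly R n)
  (s : 'I_m -> 'I_n) : mpoly R n :=
  \det (\matrix_(a < m, b < m) mderiv (s b) (f a)).

(* dgcd(f_1,...,f_m) belongs to k \ {0} (dgcd is defined up to a nonzero
   constant, so we ask that some gcd of the minors is a nonzero constant) *)
Definition dgcd_nonzero_const (R : idomainType) (n m : nat) (f : 'I_m -> mpoly R n) : Prop :=
  exists g, is_gcd (@incr_idx m n) (jac_minor f) g /\
            exists c : R, c != 0 /\ g = @mconst R n c.

(* Main.v *)
Require Import Defs.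
From HB Require Import structures.
From mathcomp Require Import all_boot all_order all_algebra.
From mathcomp Require Import boolp ring.
(* The key point is that a prime [g] of [A = k[x_1..x_n]] divides all maximal
   minors of the Jacobian matrix iff [g^2] divides [w(f)] for some irreducible
   (equivalently, some square-free) [w].  Let [K = Frac(A/g)] and let [P] be the
   kernel of the map [k[y_1..y_m] -> K] sending [y_i] to the class of [f_i].
   As the characteristic is zero, either [P = 0], or [P = (Phi)] with a partial
   derivative of [Phi] outside [P], or [P] contains [u], [v] whose gradients are
   independent modulo [P].

   If [g^2 | w(f)] with [w] square-free, differentiation gives a nonzero vector
   killing the Jacobian matrix modulo [g]: the gradient of [w] when [P = (Phi)]
   (it does not vanish in [K], otherwise [Phi^2 | w]), and a combination of the
   gradients of [u] and [v] in the third case.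

   Conversely, let [lam] be nonzero in [K^m] and kill the Jacobian matrix.
   Vectors tangent to [P] extend to derivations of [K], so [lam] is orthogonal to
   all of them.  This excludes [P = 0]; when [P = (Phi)] it makes [lam]
   proportional to the gradient of [Phi], whence [g^2 | Phi(f)].  In the third
   case [g^2] divides [u(f)^2 + v(f)^3], and [u^2 + v^3] is not a product of two
   elements of [P], so that [g^2] divides the value at [f] of its only
   irreducible factor lying in [P]. *)
Import GRing.Theory.
Set Implicit Arguments. Unset Strict Implicit. Unset Printing Implicit Defensive.
Local Open Scope ring_scope.


(** * Divisibility and prime elements in a domain *)

Definition primer (A : idomainType) (p : A) : Prop :=
  [/\ p != 0, p \isn't a GRing.unit &
      forall a b, dvdr p (a * b) -> dvdr p a \/ dvdr p b].

Section Divisibility.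
Variable A : idomainType.
Implicit Types a b c p : A.

Lemma dvdr_mull a b c : dvdr a b -> dvdr a (c * b).
Proof. by case=> d ->; exists (c * d); rewrite mulrA. Qed.

Lemma dvdr_mulr a b c : dvdr a b -> dvdr a (b * c).
Proof. by rewrite mulrC; exact: dvdr_mull. Qed.

Lemma dvdr_refl a : dvdr a a.
Proof. by exists 1; rewrite mul1r. Qed.

Lemma dvdr_trans b a c : dvdr a b -> dvdr b c -> dvdr a c.
Proof. by move=> ab [d ->]; exact: dvdr_mull. Qed.

Lemma dvdr0 a : dvdr a 0.
Proof. by exists 0; rewrite mul0r. Qed.

Lemma dvdrD a b c : dvdr a b -> dvdr a c -> dvdr a (b + c).
Proof. by move=> [x ->] [y ->]; exists (x + y); rewrite mulrDl. Qed.

Lemma dvdrB a b c : dvdr a b -> dvdr a c -> dvdr a (b - c).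
Proof. by move=> [x ->] [y ->]; exists (x - y); rewrite mulrBl. Qed.

Lemma dvdr_unit a b : dvdr a b -> b \is a GRing.unit -> a \is a GRing.unit.
Proof. by case=> c ->; rewrite unitrM => /andP[]. Qed.

Lemma primer_irreducible p : primer p -> irreducibler p.
Proof.
case=> p0 pU pP; split=> //; split=> // b c def_p.
have half x y : p = x * y -> dvdr p x -> y \is a GRing.unit.
  move=> def [z xz]; apply: (dvdr_unit _ (unitr1 _)); exists z.
  by apply: (mulIf p0); rewrite mul1r {1}def xz; rewrite mulrAC.
case: (pP b c); first by rewrite -def_p; exact: dvdr_refl.
- by move=> /(half _ _ def_p); right.
- by rewrite mulrC in def_p => /(half _ _ def_p); left.
Qed.

End Divisibility.

(** * The residue field of a prime ideal *)

Section ResidueRing.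
Variables (A : idomainType) (I : prime_idealr A).

Definition residue_ring : Type := {ideal_quot I}.
HB.instance Definition _ := GRing.ComNzRing.copy residue_ring {ideal_quot I}.

(** Units and inverses are chosen classically, to make the quotient an [idomainType], as its field
    of fractions requires. *)
Definition residue_unit (x : residue_ring) : bool := `[< exists y, y * x = 1 >].
Definition residue_inv (x : residue_ring) : residue_ring :=
  if pselect (exists y, y * x == 1) is left e then xchoose e else x.

Lemma residue_mulVx : {in residue_unit, left_inverse 1 residue_inv *%R}.
Proof.
move=> x /asboolP[y yx]; rewrite /residue_inv.
case: pselect => [e|[]]; last by exists y; rewrite yx.
by have /eqP := xchooseP e.
Qed.

Lemma residue_unitPl (x y : residue_ring) : y * x = 1 -> residue_unit x.
Proof. by move=> yx; apply/asboolP; exists y. Qed.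

Lemma residue_invr_out : {in [predC residue_unit], residue_inv =1 id}.
Proof.
move=> x; rewrite inE /= => xU; rewrite /residue_inv.
case: pselect => // e; case/negP: xU; apply/asboolP.
by have [y /eqP yx] := e; exists y.
Qed.

HB.instance Definition _ := GRing.ComNzRing_hasMulInverse.Build residue_ring
  residue_mulVx residue_unitPl residue_invr_out.

Lemma residue_idomain : GRing.integral_domain_axiom residue_ring.
Proof. exact: Quotient.rquot_IdomainAxiom. Qed.

HB.instance Definition _ :=
  GRing.ComUnitRing_isIntegral.Build residue_ring residue_idomain.

Lemma prime_ideal_residue_field : exists (K : fieldType) (phi : {rmorphism A -> K}),
  forall x, phi x = 0 <-> x \in I.
Proof.
pose q : {rmorphism A -> residue_ring} := \pi_{ideal_quot I}%qT.
exists {fraction residue_ring}, (@FracField.tofrac residue_ring \o q) => x /=.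
have q0 : (q x == 0) = (x \in I).
  by rewrite -(rmorph0 q) -[in RHS](subr0 x) Quotient.idealrBE.
by rewrite -q0 -tofrac_eq0; split => /eqP.
Qed.

End ResidueRing.

(** [K] is the fraction field of [A/(g)]: divisibility by [g] becomes vanishing in a field, where
    linear algebra applies. *)
Lemma residue_field (A : idomainType) (g : A) : primer g ->
  exists (K : fieldType) (phi : {rmorphism A -> K}),
    forall x, phi x = 0 <-> dvdr g x.
Proof.
case=> g0 gU gM; pose I : A -> bool := fun x => `[< dvdr g x >].
have Iid : idealr_closed I.
  split; first by apply/asboolP; exact: dvdr0.
  - by apply/negP => /asboolP g1; case/negP: gU; exact: dvdr_unit g1 (unitr1 _).
  - move=> a u v /asboolP gu /asboolP gv; apply/asboolP.
    by apply: dvdrD gv; exact: dvdr_mull.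
have Ipr : prime_idealr_closed I.
  by move=> u v /asboolP /gM[]/asboolP h; apply/orP; [left|right].
pose J : prime_idealr A := HB.pack I (isIdealr.Build A I Iid)
  (isPrimeIdealrClosed.Build A I Ipr).
have [K [phi phiP]] := prime_ideal_residue_field J.
by exists K, phi => x; rewrite phiP; split => [/asboolP | ?]; last exact/asboolP.
Qed.


(** * Unique factorization of polynomials *)

Definition prime_product (D : idomainType) (a : D) : Prop :=
  exists (u : D) (s : seq D), [/\ u \is a GRing.unit,
    forall p, p \in s -> primer p & a = u * \prod_(p <- s) p].

(** The factors are prime rather than merely irreducible, so uniqueness is automatic and this is the
    UFD property. *)
Definition factorial (D : idomainType) : Prop :=
  forall a : D, a != 0 -> prime_product a.

Section PrimeProduct.
Variable D : idomainType.
Implicit Types a b p : D.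

Lemma prime_product_unit a : a \is a GRing.unit -> prime_product a.
Proof. by move=> aU; exists a, [::]; split=> //; rewrite big_nil mulr1. Qed.

Lemma prime_product_prime p : primer p -> prime_product p.
Proof.
move=> pP; exists 1, [:: p]; split; first exact: unitr1.
  by move=> q; rewrite inE => /eqP ->.
by rewrite big_seq1 mul1r.
Qed.

Lemma prime_productM a b :
  prime_product a -> prime_product b -> prime_product (a * b).
Proof.
move=> [u [s [uU sP ->]]] [v [t [vU tP ->]]]; exists (u * v), (s ++ t); split.
- by rewrite unitrM uU.
- by move=> p; rewrite mem_cat => /orP[/sP|/tP].
- by rewrite big_cat /= mulrACA.
Qed.

Lemma factorial_ind (fD : factorial D) (Q : D -> Prop) :
    (forall u, u \is a GRing.unit -> Q u) ->
    (forall p a, primer p -> a != 0 -> Q a -> Q (p * a)) ->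
  forall a, a != 0 -> Q a.
Proof.
move=> QU QM a a0; move: (a0); have [u [s [uU sP ->]]] := fD a a0.
elim: s sP => [|p s IHs] sP; first by rewrite big_nil mulr1 => _; exact: QU.
rewrite big_cons mulrCA mulf_eq0 negb_or => /andP[p0 s0]; apply: QM => //.
  by apply: sP; rewrite inE eqxx.
by apply: IHs => // q qs; apply: sP; rewrite inE qs orbT.
Qed.

Lemma prime_divisor_exists a : factorial D -> a != 0 ->
  a \isn't a GRing.unit -> exists2 p, primer p & dvdr p a.
Proof.
move=> fD a0; elim/(@factorial_ind fD): a / a0 => [u ->//|p a pP _ _ _].
by exists p => //; apply: dvdr_mulr; exact: dvdr_refl.
Qed.

End PrimeProduct.

Section PolyDivisibility.
Variable D : idomainType.
Implicit Types (a b w : {poly D}) (c p : D).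

Lemma poly_lead_split a : a != 0 ->
  exists2 b : {poly D}, (size b < size a)%N & a = b + lead_coef a *: 'X^((size a).-1).
Proof.
move=> a0; exists (take_poly (size a).-1 a).
  by rewrite (leq_ltn_trans (size_take_poly _ _)) // prednK // size_poly_gt0.
rewrite -[LHS](poly_take_drop (size a).-1) -mul_polyC; congr (_ + _ * _).
apply/polyP=> i; rewrite coef_drop_poly coefC lead_coefE; case: i => //= i.
by rewrite nth_default // addSn; case: (size a) => // n; rewrite ltnS leq_addl.
Qed.

Lemma min_size_exists (P : {poly D} -> Prop) :
  (exists a, P a) -> exists2 a, P a & forall b, P b -> (size a <= size b)%N.
Proof.
move=> [a Pa]; pose Q n := `[< exists2 a, P a & size a = n >].
have exQ : exists n, Q n by exists (size a); apply/asboolP; exists a.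
case: (ex_minnP exQ) => n /asboolP[b Pb <-] bmin; exists b => // b' Pb'.
by apply: bmin; apply/asboolP; exists b'.
Qed.

Lemma dvdr_polyC c w : dvdr c%:P w <-> forall i, dvdr c w`_i.
Proof.
split=> [[d ->] i|]; first by rewrite coefMC; exists d`_i.
elim/poly_ind: w => [_|w e IH dvd]; first exact: dvdr0.
apply: dvdrD.
  apply: dvdr_mulr; apply: IH => i.
  by have := dvd i.+1; rewrite coefD coefMX coefC /= addr0.
have [d /=] := dvd 0%N; rewrite coefD coefMX coefC /= add0r => ->.
by exists d%:P; rewrite polyCM.
Qed.

Lemma polyC_unit c : (c%:P \is a GRing.unit) = (c \is a GRing.unit).
Proof.
rewrite poly_unitE coefC /= size_polyC.
by case: (eqVneq c 0) => [->|_]; rewrite ?unitr0.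
Qed.

(** If [p] divides [a * b], it divides the product of the leading coefficients, hence one of them;
    removing that leading term shortens a factor. *)
Lemma primer_polyC p : primer p -> primer p%:P.
Proof.
move=> [p0 pU pM]; split; first by rewrite polyC_eq0.
  by rewrite polyC_unit.
move=> a b; move: {2}(size a + size b)%N (leqnn (size a + size b)) => n.
elim: n a b => [|n IHn] a b.
  rewrite leqn0 addn_eq0 size_poly_eq0 => /andP[/eqP -> _] _.
  by left; exact: dvdr0.
have [->|a0] := eqVneq a 0; first by left; exact: dvdr0.
have [->|b0] := eqVneq b 0; first by right; exact: dvdr0.
move=> ab_n dvd_ab; have : dvdr p (lead_coef a * lead_coef b).
  by rewrite -lead_coefM; move/dvdr_polyC: dvd_ab; apply.
have dvd_lead (c : D) k : dvdr p c -> dvdr p%:P (c *: 'X^k).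
  by case=> d ->; exists (d *: 'X^k); rewrite [RHS]mulrC mul_polyC scalerA mulrC.
case/pM => /dvd_lead => [/(_ (size a).-1) la|/(_ (size b).-1) lb].
- have [a' sa' def_a] := poly_lead_split a0.
  have /(IHn a' b) : (size a' + size b <= n)%N.
    by rewrite -ltnS (leq_trans _ ab_n) // ltn_add2r.
  case; [|by rewrite def_a; left; exact: dvdrD|by right].
  have -> : a' = a - lead_coef a *: 'X^((size a).-1) by rewrite {1}def_a addrK.
  by rewrite mulrBl; apply: dvdrB => //; exact: dvdr_mulr.
- have [b' sb' def_b] := poly_lead_split b0.
  have /(IHn a b') : (size a + size b' <= n)%N.
    by rewrite -ltnS (leq_trans _ ab_n) // ltn_add2l.
  case; [|by left|by rewrite def_b; right; exact: dvdrD].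
  have -> : b' = b - lead_coef b *: 'X^((size b).-1) by rewrite {1}def_b addrK.
  by rewrite mulrBr; apply: dvdrB => //; exact: dvdr_mull.
Qed.

End PolyDivisibility.

(** * Gauss's lemma *)

Section GaussLemma.
Variable D : idomainType.
Hypothesis fD : factorial D.
Implicit Types (a b w q d : {poly D}) (c p : D).

Definition primitive_poly w : Prop := forall p, primer p -> ~ dvdr p%:P w.

(** The prime factors of [c] are removed one at a time: each stays prime in [{poly D}], so it
    divides [q] or [d], and dividing by a constant keeps the size. *)
Lemma gauss_split c w q d : c != 0 -> c%:P * w = q * d ->
  exists q' d', [/\ w = q' * d', size q' = size q & size d' = size d].
Proof.
move=> c0.
elim/(@factorial_ind _ fD): c / c0 w q d => [u uU|p c pP c0 IHc] w q d.
  move=> def; exists (u^-1 *: q), d; split=> //.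
    by rewrite -scalerAl -def -mul_polyC mulrA -polyCM mulVr // mul1r.
  by rewrite size_scale // invr_eq0; apply: contraTneq uU => ->; rewrite unitr0.
have [p0 _ _] := pP; have [_ _ pM] := primer_polyC pP.
have szC x : size (x * p%:P) = size x by rewrite mulrC mul_polyC size_scale.
have pI : injective (fun x => x * p%:P) by apply: mulIf; rewrite polyC_eq0.
rewrite polyCM -mulrA => def; case: (pM q d).
- by rewrite -def; apply: dvdr_mulr; exact: dvdr_refl.
- case=> x qx; rewrite qx szC; apply: IHc; apply: pI.
  by rewrite /= mulrC def qx mulrAC.
- case=> x dx; rewrite dx szC; apply: IHc; apply: pI.
  by rewrite /= mulrC def dx mulrA.
Qed.

(** A prime factor of [c] divides [w] times its cofactor but not the primitive [w], so it cancels
    from the cofactor. *)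
Lemma primitive_cancel c w b : primitive_poly w -> c != 0 ->
  dvdr w (c%:P * b) -> dvdr w b.
Proof.
move=> wP c0.
elim/(@factorial_ind _ fD): c / c0 b => [u uU|p c pP c0 IHc] b [t def].
  exists (u^-1 *: t).
  by rewrite -scalerAl -def -mul_polyC mulrA -polyCM mulVr // mul1r.
have [p0 _ _] := pP; have [_ _ pM] := primer_polyC pP.
case: (pM t w); last by move/wP => /(_ pP).
  by rewrite -def polyCM -mulrA; apply: dvdr_mulr; exact: dvdr_refl.
case=> x tx; apply: IHc; exists x; apply: (@mulfI _ p%:P).
  by rewrite polyC_eq0.
by rewrite mulrA -polyCM def tx mulrAC mulrC.
Qed.

Lemma content_split w : w != 0 ->
  exists c w', [/\ c != 0, w = c%:P * w' & primitive_poly w'].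
Proof.
move=> w0; have l0 : lead_coef w != 0 by rewrite lead_coef_eq0.
(* In this induction [l] holds the primes of the leading coefficient still to be tested, and [e]
   those already known not to divide [w]. *)
suff H l : l != 0 -> forall e w, w != 0 ->
    dvdr (lead_coef w) (l * e) -> (forall p, primer p -> dvdr p e -> ~ dvdr p%:P w) ->
    exists c w', [/\ c != 0, w = c%:P * w' & primitive_poly w'].
  apply: (H (lead_coef w) l0 1) => //; first by rewrite mulr1; exact: dvdr_refl.
  by move=> p [_ /negP pU _] /dvdr_unit/(_ (unitr1 _)).
move=> lN0; elim/(@factorial_ind _ fD): l / lN0 => {w w0 l0}[u uU|p {}l pP _ IHl] e w w0.
  move=> [t lt] eP; exists 1, w; split; rewrite ?oner_eq0 ?mul1r // => p pP pw.
  apply: (eP p pP) => //; apply: dvdr_trans (_ : dvdr (lead_coef w) e).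
    by move/dvdr_polyC: pw; apply.
  by exists (u^-1 * t); rewrite -mulrA -lt mulKr.
have [p0 pU pM] := pP => dvd eP.
have [[w1 def_w]|npw] := pselect (dvdr p%:P w).
  have w10 : w1 != 0 by apply: contraNneq w0 => w10; rewrite def_w w10 mul0r.
  have [] := IHl e w1 w10.
  - case: dvd => t; rewrite def_w lead_coefM lead_coefC => def.
    by exists t; apply: (mulfI p0); rewrite mulrA def mulrA mulrC.
  - by move=> q qP qe qw1; apply: (eP q qP qe); rewrite def_w; exact: dvdr_mulr.
  move=> c [w' [c0 def_w1 w'P]]; exists (p * c), w'; split=> //.
    by rewrite mulf_neq0.
  by rewrite def_w def_w1 polyCM mulrC mulrA.
apply: (IHl (p * e)) => //; first by rewrite mulrCA mulrA.
move=> q qP [t]; have [q0 qU qM] := qP => def_pe qw.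
case: (qM p e); first by rewrite def_pe; exists t.
  have [_ [_ pI]] := primer_irreducible pP.
  case=> x px; case: (pI _ _ px) => [xU|]; last by apply/negP.
  apply: npw; apply: dvdr_trans qw; exists (x^-1)%:P.
  by rewrite px polyCM mulrA -polyCM mulVr // mul1r.
by move=> qe; exact: (eP q qP qe).
Qed.

(** A Bezout argument without denominators. Let [d] be a shortest nonzero element of the ideal
    generated by [w] and [a]. Pseudo-division gives [c%:P * w = q * d], and [gauss_split] turns this
    into a factorization of [w] with the same sizes, so [q] or [d] is constant. If [q] is, [w]
    divides a constant multiple of [a]; if [d] is, [w] divides [d * b]. The constant then cancels,
    as [w] is primitive. *)
Lemma primitive_irreducible_primer w :
    primitive_poly w -> (1 < size w)%N ->
    (forall a b, w = a * b -> (size a <= 1)%N \/ (size b <= 1)%N) ->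
  primer w.
Proof.
move=> wP w1 wI; have w0 : w != 0 by rewrite -size_poly_gt0 ltnW.
split=> //; first by rewrite poly_unitE; case: (size w) w1 => [|[]].
move=> a b ab; pose I x := exists y z, x = y * w + z * a.
have Iw : I w by exists 1, 0; rewrite mul1r mul0r addr0.
have Ia : I a by exists 0, 1; rewrite mul1r mul0r add0r.
have [|d [d0 [y [z def_d]]] dmin] := @min_size_exists D (fun x => x != 0 /\ I x).
  by exists w.
(* The pseudo-remainder lies in the ideal and is shorter than [d], hence zero. *)
have dvdI x : I x -> exists2 c, c != 0 & exists q, c%:P * x = q * d.
  move=> [y' [z' def_x]]; exists (lead_coef d ^+ scalp x d).
    exact: Pdiv.Idomain.lc_expn_scalp_neq0.
  exists (x %/ d); have := Pdiv.Idomain.divp_eq x d.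
  set c := lead_coef d ^+ _; rewrite -mul_polyC => def.
  suff r0 : x %% d = 0 by rewrite def r0 addr0.
  apply/eqP/negP => /negP r0.
  have : (size d <= size (x %% d)%R)%N.
    apply: dmin; split=> //; exists (c%:P * y' - (x %/ d) * y), (c%:P * z' - (x %/ d) * z).
    have -> : x %% d = c%:P * x - x %/ d * d by rewrite def addrC addKr.
    by clearbody c; move: (x %/ d) => q; rewrite def_x def_d; ring.
  by rewrite leqNgt Pdiv.Idomain.ltn_modp d0.
have [c c0 [q def]] := dvdI _ Iw.
have [q' [d' [def_w sq sd]]] := gauss_split c0 def.
case: (wI _ _ def_w); rewrite ?sq ?sd => s1; [left|right].
- have /size_poly1P[e e0 def_q] : size q == 1%N.
    rewrite eqn_leq s1 size_poly_gt0; apply: contraNneq w0 => q0.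
    move: def; rewrite q0 mul0r => /eqP; rewrite mulf_eq0 polyC_eq0.
    by rewrite (negPf c0) /= => /eqP ->.
  have [c' c'0 [q'' def']] := dvdI _ Ia.
  apply: (@primitive_cancel (e * c')) => //; first exact: mulf_neq0.
  rewrite polyCM -mulrA def' mulrCA -def_q -def.
  by do 2!apply: dvdr_mull; exact: dvdr_refl.
- have /size_poly1P[e e0 def_e] : size d == 1%N by rewrite eqn_leq s1 size_poly_gt0.
  apply: (@primitive_cancel e) => //; rewrite -def_e def_d mulrDl.
  apply: dvdrD; first by apply: dvdr_mulr; apply: dvdr_mull; exact: dvdr_refl.
  by rewrite -mulrA; exact: dvdr_mull.
Qed.

(** Induction on the size, after splitting off the content: a nonconstant primitive part is prime
    unless it is a product of two nonconstant, hence shorter, factors. *)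
Theorem factorial_poly : factorial ({poly D} : idomainType).
Proof.
have facC c : c != 0 -> prime_product (c%:P : {poly D}).
  move=> c0.
  elim/(@factorial_ind _ fD): c / c0 => [u uU|p a pP _ IH].
    by apply: prime_product_unit; rewrite polyC_unit.
  by rewrite polyCM; apply: prime_productM IH; apply: prime_product_prime; exact: primer_polyC.
move=> w; move: {2}(size w) (leqnn (size w)) => n; elim: n w => [|n IHn] w.
  by rewrite leqn0 size_poly_eq0 => ->.
move=> sw w0; have [c [w' [c0 def_w w'P]]] := content_split w0.
have sw' : size w' = size w by rewrite def_w mul_polyC size_scale.
rewrite def_w; apply: prime_productM; first exact: facC.
have w'0 : w' != 0 by rewrite -size_poly_eq0 sw' size_poly_eq0.
have [s1|s1] := leqP (size w') 1.
  rewrite (size1_polyC s1); apply: facC; apply: contraNneq w'0 => e0.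
  by rewrite (size1_polyC s1) e0.
have [[a [b [def sa sb]]]|nsplit] :=
    pselect (exists a b, [/\ w' = a * b, (1 < size a)%N & (1 < size b)%N]).
  have a0 : a != 0 by rewrite -size_poly_gt0 ltnW.
  have b0 : b != 0 by rewrite -size_poly_gt0 ltnW.
  move: sw; rewrite -sw' def size_mul // => sab.
  apply: prime_productM; apply: IHn => //; rewrite -ltnS (leq_trans _ sab) //.
    by case: (size b) sb => [|[|m]] // _; rewrite !addnS /= ltnS leq_addr.
  by case: (size a) sa => [|[|m]] // _; rewrite !addSn /= ltnS leq_addl.
apply: prime_product_prime; apply: primitive_irreducible_primer => // a b def.
have [|sa] := leqP (size a) 1; first by left.
have [|sb] := leqP (size b) 1; first by right.
by case: nsplit; exists a, b.
Qed.

End GaussLemma.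

Lemma factorial_mpoly (k : fieldType) n : factorial (mpoly k n).
Proof.
elim: n => [|n IHn]; last exact: factorial_poly.
by move=> a a0; apply: prime_product_unit; rewrite unitfE.
Qed.


(** * Partial derivatives, evaluation and the chain rule *)

Section Constants.
Variables (k : idomainType) (n : nat).

Fact mconst_is_zmod_morphism : zmod_morphism (@mconst k n).
Proof. by elim: n => //= m IHm x y; rewrite IHm polyCB. Qed.

Fact mconst_is_monoid_morphism : monoid_morphism (@mconst k n).
Proof.
elim: n => [|m [IH1 IHM]] //=; split=> [|x y]; first by rewrite IH1.
by rewrite IHM polyCM.
Qed.

HB.instance Definition _ :=
  GRing.isZmodMorphism.Build k (mpoly k n) (@mconst k n) mconst_is_zmod_morphism.
HB.instance Definition _ :=
  GRing.isMonoidMorphism.Build k (mpoly k n) (@mconst k n) mconst_is_monoid_morphism.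

End Constants.

Section PartialDerivatives.
Variable k : idomainType.

Fact mderiv_is_zmod_morphism n i : zmod_morphism (@mderiv k n i).
Proof.
elim: n => [|n IHn] p q /=; first by rewrite subrr.
case: eqP => _; first exact: derivB.
have d0 : @mderiv k n i 0 = 0 by rewrite -[X in mderiv i X](subrr 0) IHn subrr.
by apply/polyP=> j; rewrite coefB !coef_map_id0 // coefB IHn.
Qed.

HB.instance Definition _ n i := GRing.isZmodMorphism.Build (mpoly k n) (mpoly k n)
  (@mderiv k n i) (@mderiv_is_zmod_morphism n i).

Lemma mderivM n i (p q : mpoly k n) :
  mderiv i (p * q) = mderiv i p * q + p * mderiv i q.
Proof.
elim: n p q => [|n IHn] p q /=; first by rewrite mul0r mulr0 addr0.
case: eqP => _; first exact: derivM.
apply/polyP=> j; rewrite coefD !coefM coef_map coefM raddf_sum -big_split /=.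
by apply: eq_bigr => l _; rewrite IHn !coef_map.
Qed.

Lemma mderiv1 n i : mderiv i (1 : mpoly k n) = 0.
Proof.
have := mderivM i (1 : mpoly k n) 1; rewrite !mulr1 mul1r => /eqP.
by rewrite -subr_eq0 opprD addNKr oppr_eq0 => /eqP.
Qed.

Lemma mderiv_ge n i (p : mpoly k n) : (n <= i)%N -> mderiv i p = 0.
Proof.
elim: n p => [|n IHn] p //= ni; rewrite gtn_eqF //.
by apply/polyP=> j; rewrite coef_map /= IHn ?coef0 // ltnW.
Qed.

Lemma mderivC n i (c : mpoly k n) :
  @mderiv k n.+1 i (c%:P : {poly mpoly k n}) = (mderiv i c)%:P.
Proof.
rewrite /=; case: eqP => [->|_]; first by rewrite derivC mderiv_ge // polyC0.
by apply/polyP=> j; rewrite coef_map !coefC /=; case: eqP => // _; rewrite raddf0.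
Qed.

Lemma mderivX n i :
  @mderiv k n.+1 i ('X : {poly mpoly k n}) = (i == n)%:R.
Proof.
rewrite /=; case: eqP => _; first by rewrite derivX.
apply/polyP=> j; rewrite coef_map coefX coef0 /=.
by case: eqP => _; rewrite ?raddf0 // mderiv1.
Qed.

Lemma mderiv_const n i (c : k) : mderiv i (mconst n c) = 0.
Proof. by elim: n => // n IHn; rewrite [mconst _ _]/= mderivC IHn. Qed.

Lemma mderiv_var n i j : (j < n)%N -> mderiv i (mvar k n j) = (i == j)%:R.
Proof.
elim: n => // n IHn; rewrite ltnS leq_eqVlt => /predU1P[->|jn].
  by rewrite [mvar _ _ _]/= eqxx mderivX.
by rewrite [mvar _ _ _]/= ltn_eqF // mderivC IHn // -polyC_natr.
Qed.

End PartialDerivatives.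

(** Unlike [msubst], this is bundled as a ring morphism into any commutative ring, and the point is
    indexed by [nat], so that the recursion needs no reindexing. *)
Fixpoint meval (k : idomainType) (K : comNzRingType) (iota : {rmorphism k -> K})
    (xi : nat -> K) (n : nat) : {rmorphism mpoly k n -> K} :=
  match n return {rmorphism mpoly k n -> K} with
  | 0 => iota
  | n.+1 => horner_morph ((fun x => mulrC _ _) : commr_rmorph (meval iota xi n) (xi n))
  end.

Section Evaluation.
Variables (k : idomainType) (K : comNzRingType) (iota : {rmorphism k -> K}).
Variable xi : nat -> K.

Lemma mevalS n (w : mpoly k n.+1) :
  meval iota xi n.+1 w = (map_poly (meval iota xi n) w).[xi n].
Proof. by []. Qed.

Lemma mevalC n (c : mpoly k n) :
  meval iota xi n.+1 (c%:P : {poly mpoly k n}) = meval iota xi n c.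
Proof. exact: horner_morphC. Qed.

Lemma mevalX n : meval iota xi n.+1 ('X : {poly mpoly k n}) = xi n.
Proof. exact: horner_morphX. Qed.

Lemma meval_const n c : meval iota xi n (mconst n c) = iota c.
Proof. by elim: n => // n IHn; rewrite [mconst _ _]/= mevalC. Qed.

Lemma meval_var n i : (i < n)%N -> meval iota xi n (mvar k n i) = xi i.
Proof.
elim: n => // n IHn; rewrite ltnS leq_eqVlt => /predU1P[->|jn].
  by rewrite [mvar _ _ _]/= eqxx mevalX.
by rewrite [mvar _ _ _]/= ltn_eqF // mevalC IHn.
Qed.

Lemma eq_meval (iota' : {rmorphism k -> K}) (xi' : nat -> K) n (w : mpoly k n) :
    iota =1 iota' -> (forall i, (i < n)%N -> xi i = xi' i) ->
  meval iota xi n w = meval iota' xi' n w.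
Proof.
move=> eqi; elim: n w => [|n IHn] w eqx; first exact: eqi.
rewrite !mevalS eqx //; congr (_.[_]); apply/polyP=> j.
by rewrite !coef_map /= IHn // => i /ltnW; exact: eqx.
Qed.

Lemma rmorph_meval (K' : comNzRingType) (phi : {rmorphism K -> K'}) n (w : mpoly k n) :
  phi (meval iota xi n w) = meval (phi \o iota) (phi \o xi) n w.
Proof.
elim: n w => [|n IHn] w //; rewrite !mevalS -horner_map -map_poly_comp.
by congr (_.[_]); apply: eq_map_poly => c; exact: IHn.
Qed.

End Evaluation.

Lemma meval_id (k : idomainType) n (w : mpoly k n) :
  meval (@mconst k n) (mvar k n) n w = w.
Proof.
elim: n w => [|n IHn] w //; rewrite mevalS [mvar k n.+1 n]/= eqxx.
rewrite (eq_map_poly (g := @polyC (mpoly k n))); last first.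
  move=> c; rewrite -[in RHS](IHn c) rmorph_meval.
  by apply: eq_meval => // i i_n /=; rewrite ltn_eqF.
elim/poly_ind: w => [|w c IHw]; first by rewrite rmorph0 horner0.
by rewrite rmorphD rmorphM /= map_polyX map_polyC hornerD hornerMX IHw hornerC.
Qed.

Lemma msubst_meval (k : idomainType) n m (w : mpoly k m) (f : 'I_m -> mpoly k n)
    (F : nat -> mpoly k n) : (forall a : 'I_m, F a = f a) ->
  msubst w f = meval (@mconst k n) F m w.
Proof.
elim: m w f => [|m IHm] w f Ff //; rewrite mevalS /map_poly horner_poly /=.
apply: eq_bigr => j _; rewrite -Ff.
by rewrite -(IHm _ (fun a => f (widen_ord (leqnSn m) a))) // => a; rewrite -Ff.
Qed.

(** These are the derivations of [B] into [K], seen as a [B]-module through [phi]. *)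
Definition derivation_along (B K : comNzRingType) (phi : B -> K) (d : B -> K) :=
  {morph d : x y / x + y} /\ forall x y, d (x * y) = phi x * d y + phi y * d x.

Definition directional (k : idomainType) (K : comNzRingType) n
    (psi : mpoly k n -> K) (c : nat -> K) (u : mpoly k n) : K :=
  \sum_(i < n) psi (mderiv i u) * c i.

Lemma derivation_mderiv (k : idomainType) n i :
  derivation_along (@idfun (mpoly k n)) (mderiv i).
Proof.
split=> [x y|x y]; first exact: raddfD.
by rewrite mderivM addrC [_ * y]mulrC.
Qed.

Section Derivations.
Variables (B K : comNzRingType) (phi : {rmorphism B -> K}) (d : B -> K).
Hypothesis dP : derivation_along phi d.

Lemma derivation0 : d 0 = 0.
Proof. by apply: (addrI (d 0)); rewrite -dP.1 !addr0. Qed.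

Lemma derivationB x y : d (x - y) = d x - d y.
Proof. by apply: (addIr (d y)); rewrite -dP.1 !subrK. Qed.

End Derivations.

Section Directional.
Variables (k : idomainType) (K : comNzRingType) (n : nat).
Variables (psi : {rmorphism mpoly k n -> K}) (c : nat -> K).

Lemma directional_derivation : derivation_along psi (directional psi c).
Proof.
split=> x y; rewrite /directional.
  by rewrite -big_split; apply: eq_bigr => i _; rewrite raddfD rmorphD mulrDl.
rewrite !mulr_sumr -big_split; apply: eq_bigr => i _ /=.
by rewrite mderivM rmorphD !rmorphM /=; ring.
Qed.

Lemma directional_var i : (i < n)%N -> directional psi c (mvar k n i) = c i.
Proof.
move=> i_n; rewrite /directional (bigD1 (Ordinal i_n)) //= mderiv_var // eqxx.
rewrite rmorph1 mul1r big1 ?addr0 // => j /negbTE ji.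
by rewrite mderiv_var // -val_eqE /= in ji *; rewrite ji rmorph0 mul0r.
Qed.

Lemma directional_const a : directional psi c (mconst n a) = 0.
Proof. by apply: big1 => i _; rewrite mderiv_const rmorph0 mul0r. Qed.

End Directional.

Lemma directional_polyC (k : idomainType) (K : comNzRingType) n
    (psi' : {rmorphism mpoly k n.+1 -> K}) (psi : mpoly k n -> K) c (a : mpoly k n) :
    (forall b : mpoly k n, psi' (b%:P : {poly mpoly k n}) = psi b) ->
  directional psi' c (a%:P : {poly mpoly k n}) = directional psi c a.
Proof.
move=> psiC; rewrite /directional big_ord_recr mderivC mderiv_ge // polyC0.
rewrite rmorph0 mul0r [LHS]addr0.
by apply: eq_bigr => i _; rewrite mderivC psiC.
Qed.

Lemma directional_polyX (k : idomainType) (K : comNzRingType) n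
    (psi : {rmorphism mpoly k n.+1 -> K}) c :
  directional psi c ('X : {poly mpoly k n}) = c n.
Proof.
have := @directional_var k K n.+1 psi c n (ltnSn n).
by rewrite [mvar _ _ _]/= eqxx.
Qed.

Section ChainRule.
Variables (k : idomainType) (B K : comNzRingType) (iota : {rmorphism k -> B}).
Variables (phi : {rmorphism B -> K}) (d : B -> K) (F : nat -> B).
Hypothesis dP : derivation_along phi d.
Hypothesis d_iota : forall a, d (iota a) = 0.

(** Both sides are derivations in [u], so it suffices to compare them on the coefficients and on the
    last variable. *)
Lemma chain_rule n (u : mpoly k n) :
  d (meval iota F n u) = directional (phi \o meval iota F n) (d \o F) u.
Proof.
elim: n u => [|n IHn] u; first by rewrite /directional big_ord0; exact: d_iota.
elim/poly_ind: u => [|q a IHq].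
  rewrite rmorph0 (derivation0 dP).
  by rewrite (derivation0 (directional_derivation _ _)).
rewrite rmorphD rmorphM /= !mevalC mevalX dP.1 dP.2 IHq IHn.
rewrite (directional_derivation _ _).1 (directional_derivation _ _).2 /=.
rewrite mevalX; congr (_ * _ + _ + _); first by rewrite directional_polyX.
by apply/esym; apply: directional_polyC => b /=; rewrite mevalC.
Qed.

End ChainRule.


(** * Algebraic relations between elements of a field *)

Lemma pchar0_natr_neq0 (k : fieldType) (D : nzRingType) (iota : {rmorphism k -> D}) j :
  [pchar k] =i pred0 -> j.+1%:R != 0 :> D.
Proof. by move=> /pcharf0P k0; rewrite -(rmorph_nat iota) fmorph_eq0 k0. Qed.

Lemma deriv_neq0 (D : idomainType) (w : {poly D}) :
  (forall j, j.+1%:R != 0 :> D) -> (1 < size w)%N -> deriv w != 0.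
Proof.
move=> D0 w1; apply/eqP => /(congr1 (fun p : {poly D} => p`_(size w).-2)).
rewrite coef_deriv coef0 -mulr_natr => /eqP; rewrite mulf_eq0 (negPf (D0 _)) orbF.
have -> : (size w).-2.+1 = (size w).-1 by case: (size w) w1 => [|[]].
by rewrite -lead_coefE lead_coef_eq0 -size_poly_eq0; case: (size w) w1.
Qed.

Lemma deriv_size_lt (D : idomainType) (w : {poly D}) :
  (1 < size w)%N -> (size (deriv w) < size w)%N.
Proof. by move=> w1; rewrite lt_size_deriv // -size_poly_gt0 ltnW. Qed.

Lemma dvdr_size (D : idomainType) (a b : {poly D}) :
  b != 0 -> dvdr a b -> (size a <= size b)%N.
Proof.
move=> b0 [c def_b]; move: b0; rewrite def_b mulf_eq0 negb_or => /andP[c0 a0].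
rewrite size_mul //; move: c0; rewrite -size_poly_gt0.
by case: (size c) => // s _; rewrite addSn leq_addl.
Qed.

(** In the last variable that occurs in [g], the derivative is nonzero, by characteristic zero, and
    of smaller degree than [g]. *)
Lemma not_dvdr_gradient (k : fieldType) n (g : mpoly k n) : [pchar k] =i pred0 ->
  g != 0 -> g \isn't a GRing.unit -> exists j : 'I_n, ~ dvdr g (mderiv j g).
Proof.
move=> k0; elim: n g => [|n IHn] g g0 gU; first by rewrite unitfE g0 in gU.
have [g1|g1] := ltnP 1 (size (g : {poly mpoly k n})).
  exists ord_max; rewrite /= eqxx => /dvdr_size; rewrite leqNgt deriv_size_lt //.
  suff dg0 : deriv (g : {poly mpoly k n}) != 0 by move/(_ dg0).
  by apply: deriv_neq0 => // j; exact: (pchar0_natr_neq0 (@mconst k n)).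
have gC := size1_polyC g1; set c := _`_0 in gC.
have [||j nj] := IHn c.
- by apply: contraNneq g0 => c0; rewrite gC c0.
- by apply: contraNN gU; rewrite gC polyC_unit.
exists (widen_ord (leqnSn n) j); rewrite gC mderivC => /dvdr_polyC/(_ 0%N).
by rewrite coefC.
Qed.

Lemma prime_factor_in_kernel (D K : idomainType) (psi : {rmorphism D -> K}) w :
    factorial D -> w != 0 -> psi w = 0 ->
  exists p c, [/\ primer p, psi p = 0 & w = p * c].
Proof.
move=> fD w0; elim/(@factorial_ind _ fD): w / w0 => [u uU|p a pP _ IHa].
  by move=> u0; have := rmorph_unit psi uU; rewrite u0 unitr0.
rewrite rmorphM => /eqP; rewrite mulf_eq0 => /orP[]/eqP => [p0|/IHa].
  by exists p, a.
by move=> [q [c [qP q0 ->]]]; exists q, (p * c); split=> //; rewrite mulrCA.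
Qed.

Section Relations.
Variables (k K : fieldType) (iota : {rmorphism k -> K}) (xi : nat -> K).
Hypothesis k0 : [pchar k] =i pred0.
Local Notation ev := (meval iota xi).

Let natr_neq0 j : j.+1%:R != 0 :> K.
Proof. exact: (pchar0_natr_neq0 iota). Qed.

Lemma meval_map0 n (w : {poly mpoly k n}) : map_poly (ev n) w = 0 -> ev n.+1 w = 0.
Proof. by move=> w0; rewrite mevalS w0 horner0. Qed.

(** [v] is the minimal polynomial of [xi n] over the field generated by the earlier coordinates, up
    to clearing denominators. Its derivative is shorter and nonzero in characteristic zero, so it
    does not vanish at [xi n]. *)
Lemma algebraic_relation n :
    (exists w : {poly mpoly k n}, ev n.+1 w = 0 /\ map_poly (ev n) w != 0) ->
  exists v : {poly mpoly k n}, [/\ ev n.+1 v = 0, ev n (lead_coef v) != 0,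
    ev n.+1 (deriv v) != 0 & forall w : {poly mpoly k n}, ev n.+1 w = 0 ->
      (size w < size v)%N -> map_poly (ev n) w = 0].
Proof.
move=> /min_size_exists[v [ev0 vN0] vmin].
have small (w : {poly mpoly k n}) :
    ev n.+1 w = 0 -> (size w < size v)%N -> map_poly (ev n) w = 0.
  move=> w0; rewrite ltnNge => sw; apply/eqP; apply: contraNT sw => wN0.
  by apply: vmin.
have v0 : v != 0 by apply: contraNneq vN0 => ->; rewrite rmorph0.
(* Otherwise dropping the leading term would give a shorter relation with the same image. *)
have lN0 : ev n (lead_coef v) != 0.
  apply/negP => /eqP l0; have [b sb def_v] := poly_lead_split v0.
  have map_vb : map_poly (ev n) v = map_poly (ev n) b.
    by rewrite {1}def_v rmorphD /= map_polyZ /= l0 scale0r addr0.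
  by move: vN0; rewrite map_vb small ?eqxx // mevalS -map_vb.
have sv : (1 < size v)%N.
  rewrite ltnNge; apply/negP => /size1_polyC def_v.
  by move: lN0 ev0; rewrite def_v mevalC lead_coefC => /eqP.
exists v; split=> //; apply/negP => /eqP dv0.
have := small _ dv0 (deriv_size_lt sv); rewrite -deriv_map; apply/eqP.
by apply: (deriv_neq0 natr_neq0); rewrite size_poly_eq.
Qed.

Definition no_relation n : Prop := forall u : mpoly k n, ev n u = 0 -> u = 0.

(* The kernel is a prime ideal of height one. *)
Definition principal_relations n : Prop := exists Phi : mpoly k n,
  [/\ primer Phi, ev n Phi = 0, forall u, ev n u = 0 -> dvdr Phi u
    & exists i, ev n (mderiv i Phi) != 0].

(* The kernel has height at least two: since [mderiv j u = 0], the gradients of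
   [u] and [v] are linearly independent at [xi]. *)
Definition two_relations n : Prop := exists (u v : mpoly k n) i j,
  [/\ ev n u = 0, ev n v = 0, mderiv j u = 0, ev n (mderiv i u) != 0
    & ev n (mderiv j v) != 0].

(** Induction on the number of coordinates. A coordinate transcendental over the previous ones
    preserves the case; an algebraic one leads from no relation to a principal kernel, and from a
    principal kernel to two relations. *)
Lemma relations_trichotomy n :
  [\/ no_relation n, principal_relations n | two_relations n].
Proof.
elim: n => [|n IHn].
  by constructor 1 => u /eqP; rewrite fmorph_eq0 => /eqP.
have lift2 : two_relations n -> two_relations n.+1.
  move=> [u [v [i [j [u0 v0 ju iu jv]]]]].
  exists (u%:P : {poly mpoly k n}), (v%:P : {poly mpoly k n}), i, j.
  by rewrite !mevalC !mderivC !mevalC ju polyC0.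
have [alg|trans] := pselect (exists w : {poly mpoly k n},
    ev n.+1 w = 0 /\ map_poly (ev n) w != 0); last first.
  (* In the transcendental case all coefficients of a relation are themselves relations. *)
  have {}trans (w : {poly mpoly k n}) : ev n.+1 w = 0 -> forall j, ev n w`_j = 0.
    move=> w0 j; rewrite -coef_map; suff -> : map_poly (ev n) w = 0 by rewrite coef0.
    by apply/eqP/negP => /negP wN0; apply: trans; exists w.
  case: IHn => [free|[Phi [PhiP Phi0 PhiD [i iPhi]]]|/lift2].
  - constructor 1 => w /trans w0; apply/polyP => j; rewrite coef0.
    exact: free (w0 j).
  - constructor 2; exists (Phi%:P : {poly mpoly k n}); split.
    + exact: primer_polyC.
    + by rewrite mevalC.
    + by move=> w /trans w0; apply/dvdr_polyC => j; exact: PhiD.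
    + by exists i; rewrite mderivC mevalC.
  - by constructor 3.
have [v [v0 lvN0 dvN0 vmin]] := algebraic_relation alg.
case: IHn => [free|[Phi [PhiP Phi0 PhiD [i iPhi]]]|/lift2]; last by constructor 3.
- have {}vmin (w : {poly mpoly k n}) : ev n.+1 w = 0 -> (size w < size v)%N -> w = 0.
    move=> w0 sw; apply/polyP => j; rewrite coef0; apply: free.
    by rewrite -coef_map vmin // coef0.
  have vN0 : (v : mpoly k n.+1) != 0.
    by apply: contraNneq lvN0 => ->; rewrite lead_coef0 rmorph0.
  have [Phi [q [PhiP Phi0 def_v]]] :=
    prime_factor_in_kernel (@factorial_mpoly k n.+1) vN0 v0.
  have Phiv : dvdr Phi (v : mpoly k n.+1) by exists q; rewrite mulrC.
  have [Phi_n0 _ PhiM] := PhiP.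
  have {}vmin (w : {poly mpoly k n}) :
      ev n.+1 w = 0 -> (size w < size (Phi : {poly mpoly k n}))%N -> w = 0.
    by move=> w0 sw; apply: vmin => //; apply: leq_trans sw _; exact: dvdr_size.
  have Phi1 : (1 < size (Phi : {poly mpoly k n}))%N.
    rewrite ltnNge; apply/negP => /size1_polyC def_Phi; case/negP: Phi_n0.
    by move: Phi0; rewrite def_Phi mevalC => /free ->.
  constructor 2; exists Phi; split=> // [u u0|].
    have c0 := Pdiv.Idomain.lc_expn_scalp_neq0 (u : {poly mpoly k n}) Phi.
    have := Pdiv.Idomain.divp_eq (u : {poly mpoly k n}) Phi.
    rewrite -mul_polyC; move: (lead_coef _ ^+ _) c0 => c c0 def.
    have r0 : (u : {poly mpoly k n}) %% Phi = 0.
      apply: vmin; last by rewrite Pdiv.Idomain.ltn_modp.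
      have := congr1 (ev n.+1) def.
      by rewrite rmorphD !rmorphM /= u0 Phi0 !mulr0 add0r => /esym.
    (* [Phi] is prime and divides [c * u]; having positive degree in the last variable, it cannot
       divide the nonzero constant [c]. *)
    case: (PhiM c%:P u) => //; first by rewrite def r0 addr0; eexists.
    by move/dvdr_size; rewrite polyC_eq0 c0 size_polyC c0 leqNgt Phi1 => /(_ isT).
  exists n; rewrite /= eqxx; apply/negP => /eqP dPhi0.
  have /eqP := vmin _ dPhi0 (deriv_size_lt Phi1); apply/negP; apply: deriv_neq0 => // j.
  exact: (pchar0_natr_neq0 (@mconst k n)).
(* [Phi] is free of the last variable, while the derivative of [v] in that variable does not vanish
   at [xi]. *)
- constructor 3; exists (Phi%:P : {poly mpoly k n}), v, i, n.
  rewrite mevalC !mderivC !mevalC; split=> //; first by rewrite mderiv_ge.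
  by rewrite /= eqxx.
Qed.

(** Such [c] are the values on the coordinates [xi i] of the derivations over [k] from the ring they
    generate to [K]. *)
Definition tangent n (c : nat -> K) : Prop :=
  forall u : mpoly k n, ev n u = 0 -> directional (ev n) c u = 0.

(** A derivation extends to one more generator: with an arbitrary value, here 0, if it is
    transcendental, and otherwise with the value forced by differentiating [v], which is
    separable. *)
Lemma tangent_extend1 n c : tangent n c ->
  exists2 c', forall i, (i < n)%N -> c' i = c i & tangent n.+1 c'.
Proof.
move=> tc; pose c' z i := if i == n then z else c i.
have c'E z i : (i < n)%N -> c' z i = c i by move=> i_n; rewrite /c' ltn_eqF.
have dP z := directional_derivation (ev n.+1) (c' z).
have dC z (a : mpoly k n) :
    directional (ev n.+1) (c' z) (a%:P : {poly mpoly k n}) = directional (ev n) c a.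
  rewrite (directional_polyC (psi := ev n)); last by move=> b; exact: mevalC.
  by apply: eq_bigr => i _; rewrite c'E.
have d0 z (w : {poly mpoly k n}) :
    map_poly (ev n) w = 0 -> directional (ev n.+1) (c' z) w = 0.
  elim/poly_ind: w => [_|q a IHq]; first exact: derivation0 (dP z).
  move=> w0; have coef0w j : ev n (q * 'X + a%:P)`_j = 0 by rewrite -coef_map w0 coef0.
  have q0 : map_poly (ev n) q = 0.
    apply/polyP => j; rewrite coef_map coef0 /=.
    by have := coef0w j.+1; rewrite coefD coefMX coefC addr0.
  have a0 : ev n a = 0 by have := coef0w 0%N; rewrite coefD coefMX coefC add0r.
  rewrite (dP z).1 (dP z).2 dC tc // IHq // meval_map0 //.
  by rewrite mul0r mulr0 !addr0.
have [alg|trans] := pselect (exists w : {poly mpoly k n},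
    ev n.+1 w = 0 /\ map_poly (ev n) w != 0); last first.
  exists (c' 0) => [|w w0]; first exact: c'E.
  by apply: d0; apply/eqP/negP => /negP wN0; apply: trans; exists w.
have [v [v0 lvN0 dvN0 vmin]] := algebraic_relation alg.
(* The unique solution of the linear equation that makes the derivative of [v] zero. *)
pose z := - directional (ev n.+1) (c' 0) v / ev n.+1 (deriv v).
have dv : directional (ev n.+1) (c' z) v = 0.
  rewrite /directional big_ord_recr /= eqxx {2}/c' eqxx mulrC divfK //.
  rewrite /directional big_ord_recr /= eqxx {3}/c' eqxx mulr0 [X in - X]addr0.
  apply/eqP; rewrite subr_eq0; apply/eqP; apply: eq_bigr => i _.
  by rewrite !c'E.
exists (c' z) => [|w w0]; first exact: c'E.
have def := Pdiv.Idomain.divp_eq (w : {poly mpoly k n}) v.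
rewrite -mul_polyC in def.
have r0 : ev n.+1 ((w : {poly mpoly k n}) %% v) = 0.
  have := congr1 (ev n.+1) def.
  by rewrite rmorphD !rmorphM /= w0 v0 !mulr0 add0r => /esym.
have dr : directional (ev n.+1) (c' z) ((w : {poly mpoly k n}) %% v) = 0.
  apply: d0; apply: vmin => //; rewrite Pdiv.Idomain.ltn_modp.
  by apply: contraNneq lvN0 => ->; rewrite lead_coef0 rmorph0.
have := congr1 (directional (ev n.+1) (c' z)) def.
rewrite (dP z).1 !(dP z).2 dr dv v0 w0 !mul0r mulr0 !addr0 => /eqP.
by rewrite mulf_eq0 mevalC rmorphXn expf_eq0 (negPf lvN0) andbF => /eqP.
Qed.

Lemma tangent_extend m n c : tangent m c ->
  exists2 c', forall i, (i < m)%N -> c' i = c i & tangent (n + m) c'.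
Proof.
move=> tc; elim: n => [|n [c' c'E /tangent_extend1[c'' c''E tc'']]]; first by exists c.
exists c'' => // i im; rewrite c''E ?c'E //; exact: leq_trans im (leq_addl _ _).
Qed.

End Relations.

(* Extending [c] to the coordinates [x_j] of the graph of [F] writes [c] as the
   image of a vector under the Jacobian matrix of [F] over [K]. *)
Lemma tangent_jacobian_kernel (k K : fieldType) n m
    (phi : {rmorphism mpoly k n -> K}) (F : nat -> mpoly k n) (lam c : nat -> K) :
    [pchar k] =i pred0 ->
    (forall j, (j < n)%N -> \sum_(i < m) lam i * phi (mderiv j (F i)) = 0) ->
    tangent (phi \o @mconst k n) (phi \o F) m c ->
  \sum_(i < m) lam i * c i = 0.
Proof.
move=> k0 lamP tc.
pose iota := phi \o @mconst k n.
(* The generic point of the graph of [F]: first the values of [F], then the classes of the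
   variables. *)
pose xi i := if (i < m)%N then phi (F i) else phi (mvar k n (i - m)).
have evE (u : mpoly k m) : meval iota (phi \o F) m u = meval iota xi m u.
  by apply: eq_meval => // i im; rewrite /xi im.
have tc' : tangent iota xi m c.
  move=> u; rewrite -evE => /tc <-; apply: eq_bigr => i _.
  by rewrite -evE.
have [c' c'E {}tc'] := tangent_extend k0 n tc'.
pose sh := meval (@mconst k (n + m)) (fun j => mvar k (n + m) (m + j)) n.
have ev_sh h : meval iota xi (n + m) (sh h) = phi h.
  rewrite rmorph_meval -[in RHS](meval_id h) rmorph_meval.
  apply: eq_meval => [a|j jn] /=; first by rewrite meval_const.
  by rewrite meval_var 1?addnC ?ltn_add2r // /xi ltnNge leq_addl addnK.
have cE i : (i < m)%N ->
    c i = \sum_(j < n) phi (mderiv j (F i)) * c' (m + j)%N.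
  move=> im; have inm : (i < n + m)%N by apply: leq_trans im (leq_addl _ _).
  have dP := directional_derivation (meval iota xi (n + m)) c'.
  (* The equation of the graph, [y_i - F_i(x)], is a relation; its derivative along [c'] expresses
     [c i] through the Jacobian matrix. *)
  have := tc' (mvar k (n + m) i - sh (F i)).
  rewrite rmorphB /= ev_sh meval_var // /xi im subrr => /(_ erefl).
  rewrite (derivationB dP) directional_var // c'E // => /eqP; rewrite subr_eq0 => /eqP ->.
  rewrite (chain_rule _ dP) => [|a]; last exact: directional_const.
  apply: eq_bigr => j _ /=; rewrite -/sh ev_sh directional_var //.
  by rewrite addnC ltn_add2r.
under eq_bigr => i _ do rewrite cE // mulr_sumr.
rewrite exchange_big big1 //= => j _.
under eq_bigr => i _ do rewrite mulrA.
by rewrite -mulr_suml lamP // mul0r.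
Qed.

(* The hypersurface [u^2 + v^3 = 0] has a cusp, hence a single branch, along
   the zero set of the prime ideal [ker psi]. *)
Lemma cusp_not_product (R K : idomainType) (psi : {rmorphism R -> K})
    (D1 D2 : R -> R) (u v a b : R) :
    (forall j, j.+1%:R != 0 :> K) ->
    derivation_along idfun D1 -> derivation_along idfun D2 ->
    psi u = 0 -> psi v = 0 -> D1 v = 0 -> D2 u = 0 ->
    psi (D1 u) != 0 -> psi (D2 v) != 0 ->
    u ^+ 2 + v ^+ 3 = a * b -> psi a = 0 -> psi b = 0 -> False.
Proof.
move=> K0 d1 d2 u0 v0 D1v D2u D1u D2v E a0 b0.
rewrite expr2 !exprS expr0 mulr1 in E.
have simp := (rmorphD, rmorphM, u0, v0, a0, b0, rmorph0, mul0r, mulr0, add0r, addr0).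
(* After [psi], the second derivatives of [E] give [D1 a * D1 b = (D1 u)^2], nonzero, and then
   [D2 a = D2 b = 0]. Hence the third [D2]-derivative of [a * b] vanishes, whereas that of [v^3] is
   [6 (D2 v)^3]. *)
have e22 := congr1 (fun x => psi (D2 (D2 x))) E.
have e21 := congr1 (fun x => psi (D1 (D2 x))) E.
have e11 := congr1 (fun x => psi (D1 (D1 x))) E.
have e222 := congr1 (fun x => psi (D2 (D2 (D2 x)))) E.
have D10 := derivation0 d1; have D20 := derivation0 d2.
rewrite !(d2.1, d2.2, D2u, D20) /= in e22.
rewrite !(d2.1, d2.2, d1.1, d1.2, D2u, D1v, D20, D10) /= in e21.
rewrite !(d1.1, d1.2, D1v, D10) /= in e11.
rewrite !(d2.1, d2.2, D2u, D20) /= in e222.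
rewrite !simp in e22 e21 e11 e222.
have half (x : K) : x + x = 0 -> x = 0.
  by move/eqP; rewrite -mulr2n -mulr_natr mulf_eq0 (negPf (K0 1%N)) orbF => /eqP.
have [p0 q0] : psi (D1 a) != 0 /\ psi (D1 b) != 0.
  apply/andP; rewrite -negb_or -mulf_eq0; apply/negP => /eqP pq0.
  move: e11; rewrite [psi (D1 b) * _]mulrC pq0 addr0 => /half/eqP.
  by rewrite mulf_eq0 orbb (negPf D1u).
have [x0 y0] : psi (D2 a) = 0 /\ psi (D2 b) = 0.
  move: e22; rewrite mulrC => /esym/half/eqP; rewrite mulf_eq0 => /orP[]/eqP z0.
    move: e21; rewrite z0 mul0r addr0 => /esym/eqP.
    by rewrite mulf_eq0 (negPf p0) orbF => /eqP.
  move: e21; rewrite z0 mul0r add0r => /esym/eqP.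
  by rewrite mulf_eq0 (negPf q0) orbF => /eqP.
move: e222; rewrite x0 y0 !simp; set V := psi (D2 v) => e6.
have /eqP : V ^+ 3 * 6%:R = 0 by rewrite -{}e6; ring.
by rewrite mulf_eq0 (negPf (K0 5%N)) orbF expf_eq0 /= (negPf D2v).
Qed.


(** * Jacobian minors modulo a prime *)

(** The image of [s] has [m] elements; [s'] enumerates it in increasing order. *)
Lemma incr_idx_sort m n (s : 'I_m -> 'I_n) : injective s ->
  exists2 s' : 'I_m -> 'I_n, incr_idx s' & forall a, exists b, s a = s' b.
Proof.
move=> s_inj; pose S := [set s a | a : 'I_m].
have cS : #|S| = m by rewrite card_imset // card_ord.
exists (fun b => enum_val (cast_ord (esym cS) b)) => [a b ab|a].
  have x0 := s a; rewrite !(enum_val_nth x0) /=.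
  have srt : sorted (relpre val ltn) (enum S).
    rewrite /enum_mem -enumT; apply: sorted_filter => [x y z|].
      exact: (@ltn_trans (val x)).
    by rewrite -sorted_map val_enum_ord iota_ltn_sorted.
  apply: (sorted_ltn_nth (leT := relpre val ltn)) => //.
  - by move=> x y z; exact: (@ltn_trans (val x)).
  - by rewrite inE -cardE cS.
  - by rewrite inE -cardE cS.
have sS : s a \in S by apply: imset_f.
exists (cast_ord cS (enum_rank_in sS (s a))).
by rewrite cast_ordK enum_rankK_in.
Qed.

Section Minors.
Variables (K : fieldType) (m n : nat) (M : 'M[K]_(m, n)).

Lemma kernel_minors (v : 'rV_m) : v != 0 -> v *m M = 0 ->
  forall s : 'I_m -> 'I_n, \det (colsub s M) = 0.
Proof.
move=> v0 vM s; apply/eqP/det0P; exists v => //.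
apply/rowP => b; have /rowP/(_ (s b)) := vM; rewrite !mxE => {2}<-.
by apply: eq_bigr => a _; rewrite !mxE.
Qed.

(** If the rows of [M] were independent, [m] of its columns would be too, and in increasing order
    they would form a nonzero minor. *)
Lemma minors_kernel :
    (forall s : 'I_m -> 'I_n, incr_idx s -> \det (colsub s M) = 0) ->
  exists2 v : 'rV_m, v != 0 & v *m M = 0.
Proof.
move=> M0; have [rf|] := boolP (row_free M); last first.
  by rewrite -kermx_eq0 => /rowV0Pn[v /sub_kermxP vM v0]; exists v.
have rfT : row_full M^T by rewrite /row_full mxrank_tr.
have [s incr_s ss] := incr_idx_sort (@fullrankfun_inj _ _ _ _ rfT).
have := M0 s incr_s; rewrite -det_tr => /eqP.
suff : (colsub s M)^T \in unitmx by rewrite unitmxE unitfE => /negPf ->.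
rewrite -row_full_unit -sub1mx (submx_trans _ (_ : rowsub (fullrankfun rfT) M^T <= _)%MS) //.
  by rewrite sub1mx fullrowsub_full.
apply/row_subP => a; have [b ab] := ss a.
rewrite row_rowsub ab (eq_row_sub b) //.
by apply/rowP => i; rewrite !mxE.
Qed.

End Minors.

(** Turns a family on ['I_m] into the [nat]-indexed point that [meval] takes. *)
Definition ext_ord (T : Type) (x0 : T) m (f : 'I_m -> T) (i : nat) : T :=
  if insub i is Some a then f a else x0.

Lemma ext_ordE (T : Type) (x0 : T) m (f : 'I_m -> T) (a : 'I_m) :
  ext_ord x0 f a = f a.
Proof. by rewrite /ext_ord valK. Qed.

Lemma sum_delta (R : nzRingType) m (X : 'I_m -> R) (l : 'I_m) :
  \sum_(a < m) X a * (a == l :> nat)%:R = X l.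
Proof.
rewrite (bigD1 l) //= eqxx mulr1 big1 ?addr0 // => a /negPf.
by rewrite -val_eqE /= => ->; rewrite mulr0.
Qed.

Section Jacobian.
Variables (k K : fieldType) (n m : nat) (f : 'I_m -> mpoly k n) (g : mpoly k n).
Variable phi : {rmorphism mpoly k n -> K}.
Hypothesis k0 : [pchar k] =i pred0.
Hypothesis phiP : forall x, phi x = 0 <-> dvdr g x.

Let F := ext_ord 0 f.
Let ev := meval (phi \o @mconst k n) (phi \o F) m.

Lemma phi_msubst w : phi (msubst w f) = ev w.
Proof.
rewrite (@msubst_meval k n m w f F); last by move=> a; rewrite /F ext_ordE.
by rewrite rmorph_meval.
Qed.

Let phi_g : phi g = 0.
Proof. by apply/phiP; exact: dvdr_refl. Qed.

(** Differentiate [w(f) = h g]: the chain rule gives the left side, and the term containing [g] dies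
    in [K]. *)
Lemma gradient_msubst w h j : msubst w f = h * g ->
  \sum_(l < m) ev (mderiv l w) * phi (mderiv j (f l)) = phi h * phi (mderiv j g).
Proof.
move=> def; have := congr1 (fun x => phi (mderiv j x)) def.
rewrite /= mderivM rmorphD !rmorphM /= phi_g mulr0 add0r => <-.
rewrite (@msubst_meval k n m w f F); last by move=> a; rewrite /F ext_ordE.
rewrite (chain_rule F (derivation_mderiv k n j)) => [|a]; last exact: mderiv_const.
rewrite /directional rmorph_sum; apply: eq_bigr => l _ /=.
by rewrite rmorphM rmorph_meval /F ext_ordE.
Qed.

Let J := \matrix_(a < m, j < n) phi (mderiv j (f a)).

Lemma phi_jac_minor s : phi (jac_minor f s) = \det (colsub s J).
Proof.
by rewrite /jac_minor -det_map_mx; congr (\det _); apply/matrixP => a b; rewrite !mxE.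
Qed.

Lemma jacobian_kernel_minors (t : nat -> K) i : (i < m)%N -> t i != 0 ->
    (forall j : 'I_n, \sum_(l < m) t l * phi (mderiv j (f l)) = 0) ->
  forall s, phi (jac_minor f s) = 0.
Proof.
move=> im ti tJ s; rewrite phi_jac_minor.
apply: (@kernel_minors _ _ _ _ (\row_l t l)).
  apply/eqP => /rowP/(_ (Ordinal im)); rewrite !mxE /= => /eqP.
  exact/negP.
apply/rowP => j; rewrite !mxE -[RHS](tJ j).
by apply: eq_bigr => l _; rewrite !mxE.
Qed.

Lemma mderiv_lt i (w : mpoly k m) : ev (mderiv i w) != 0 -> (i < m)%N.
Proof.
by apply: contraNltn => /mderiv_ge ->; rewrite rmorph0.
Qed.

Lemma square_dvdr_minors w : squarefreer w -> dvdr (g ^+ 2) (msubst w f) ->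
  forall s, phi (jac_minor f s) = 0.
Proof.
move=> wS [h def]; have def_w : msubst w f = (h * g) * g by rewrite def expr2 mulrA.
have evw : ev w = 0 by rewrite -phi_msubst def_w rmorphM /= phi_g mulr0.
have [free|[Phi [PhiP Phi0 PhiD [i iPhi]]]|[u [v [i [j [u0 v0 ju iu jv]]]]]] :=
  relations_trichotomy (phi \o @mconst k n) (phi \o F) k0 m.
(* Here [w = 0], which is not square-free since [0 = 0^2 * 0]. *)
- by case: wS; exists 0, 0; rewrite (free _ evw) mulr0 unitr0.
- have [t def_t] := PhiD _ evw.
  have [_ PhiU _] := PhiP.
  have im := mderiv_lt iPhi.
  suff iw : ev (mderiv i w) != 0.
    apply: (jacobian_kernel_minors (t := fun l => ev (mderiv l w)) im iw) => l.
    by rewrite (gradient_msubst l def_w) rmorphM /= phi_g mulr0 mul0r.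
  (* With [w = t Phi], a vanishing derivative would put [t] in the kernel, so that [Phi^2] would
     divide [w]. *)
  apply/negP => /eqP; rewrite def_t mderivM rmorphD !rmorphM /= Phi0 mulr0 add0r.
  move/eqP; rewrite mulf_eq0 (negPf iPhi) orbF => /eqP/PhiD[t' def_t'].
  by apply: wS; exists Phi, t'; split=> //; rewrite def_t def_t' expr2 -mulrA mulrC.
- have [h1 def_u] : dvdr g (msubst u f) by apply/phiP; rewrite phi_msubst.
  have [h2 def_v] : dvdr g (msubst v f) by apply/phiP; rewrite phi_msubst.
  have [h10|h1n0] := eqVneq (phi h1) 0.
    apply: (jacobian_kernel_minors (t := fun l => ev (mderiv l u)) (mderiv_lt iu) iu) => l.
    by rewrite (gradient_msubst l def_u) h10 mul0r.
  (* The Jacobian matrix sends the gradients of [u] and [v] to [h1] and [h2] times the gradient of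
     [g], so this combination is killed. Its entry at [j] is nonzero because [mderiv j u = 0]. *)
  apply: (@jacobian_kernel_minors
    (fun l => phi h2 * ev (mderiv l u) - phi h1 * ev (mderiv l v)) j (mderiv_lt jv)).
    by rewrite ju rmorph0 mulr0 sub0r oppr_eq0 mulf_neq0.
  move=> l; under eq_bigr => a _ do rewrite mulrBl -!mulrA.
  rewrite sumrB -!mulr_sumr (gradient_msubst l def_u) (gradient_msubst l def_v).
  by rewrite mulrCA subrr.
Qed.

Lemma minors_dvdr_square : primer g ->
    (forall s, incr_idx s -> phi (jac_minor f s) = 0) ->
  exists2 w : mpoly k m, irreducibler w & dvdr (g ^+ 2) (msubst w f).
Proof.
move=> gP minors0; have [gn0 gU gM] := gP.
have /minors_kernel[lam lam0 lamJ] s : incr_idx s -> \det (colsub s J) = 0.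
  by move=> si; rewrite -phi_jac_minor minors0.
have [i lami] : exists i, lam 0 i != 0.
  apply/existsP; apply: contraNT lam0; rewrite negb_exists => /forallP l0.
  by apply/eqP/rowP => i; rewrite mxE; apply/eqP; move: (l0 i); rewrite negbK.
have lamP j : (j < n)%N -> \sum_(a < m) lam 0 a * phi (mderiv j (f a)) = 0.
  move=> jn; have /rowP/(_ (Ordinal jn)) := lamJ; rewrite !mxE => {2}<-.
  by apply: eq_bigr => a _; rewrite !mxE.
have lamT c : tangent (phi \o @mconst k n) (phi \o F) m c -> \sum_(a < m) lam 0 a * c a = 0.
  move=> tc; rewrite -[RHS](tangent_jacobian_kernel (lam := ext_ord 0 (lam 0)) k0 _ tc).
    by apply: eq_bigr => a _; rewrite ext_ordE.
  move=> j jn; rewrite -[RHS](lamP j jn); apply: eq_bigr => a _.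
  by rewrite /F !ext_ordE.
have [free|[Phi [PhiP Phi0 PhiD [i0 iPhi]]]|[u [v [i1 [j1 [u0 v0 ju iu jv]]]]]] :=
  relations_trichotomy (phi \o @mconst k n) (phi \o F) k0 m.
(* Without relations every vector is tangent, in particular the basis vector at [i]. *)
- case/eqP: lami; rewrite -(sum_delta (lam 0) i); apply: (lamT (fun a => (a == i :> nat)%:R)).
  by move=> u /free ->; exact: derivation0 (directional_derivation _ _).
- pose P a := ev (mderiv a Phi).
  have lamPhi (l : 'I_m) : lam 0 i * P l = P i * lam 0 l.
    (* This vector is orthogonal to the gradient of [Phi], hence tangent; so [lam] is proportional
       to that gradient. *)
    pose c (a : nat) := P i * (a == l :> nat)%:R - P l * (a == i :> nat)%:R.
    have cE (X : 'I_m -> K) : \sum_(a < m) X a * c a = P i * X l - P l * X i.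
      rewrite -(sum_delta X l) -(sum_delta X i) !mulr_sumr -sumrB.
      by apply: eq_bigr => a _; rewrite /c; ring.
    have tc : tangent (phi \o @mconst k n) (phi \o F) m c.
      move=> u /PhiD[t ->]; rewrite (directional_derivation _ _).2 Phi0 mul0r addr0.
      by rewrite /directional (cE (fun a => P a)) [P i * _]mulrC subrr mulr0.
    have := lamT c tc; rewrite cE => /eqP; rewrite subr_eq0 => /eqP ->.
    by rewrite mulrC.
  have [h def_Phi] : dvdr g (msubst Phi f) by apply/phiP; rewrite phi_msubst.
  have [j jg] := not_dvdr_gradient k0 gn0 gU.
  (* By proportionality this equals [P i] times an entry of [lam *m J]. As [g] does not divide
     [mderiv j g], it divides [h]. *)
  have : lam 0 i * (phi h * phi (mderiv j g)) = 0.
    rewrite -(gradient_msubst j def_Phi) mulr_sumr.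
    under eq_bigr => l _ do rewrite mulrA lamPhi -mulrA.
    by rewrite -mulr_sumr lamP // mulr0.
  move/eqP; rewrite !mulf_eq0 (negPf lami) /= => /orP[]/eqP/phiP // [h' def_h].
  exists Phi; first exact: primer_irreducible.
  by exists h'; rewrite def_Phi def_h expr2 mulrA.
- pose w := u ^+ 2 + v ^+ 3.
  have noprod a b : w = a * b -> ev a = 0 -> ev b = 0 -> False.
    (* The first derivation is chosen to kill [v]; the second, [mderiv j1], kills [u]. *)
    apply: (@cusp_not_product _ _ _
      (fun x => mderiv j1 v * mderiv i1 x - mderiv i1 v * mderiv j1 x) (mderiv j1)) => //.
    + by move=> l; exact: (pchar0_natr_neq0 (phi \o @mconst k n)).
    + split=> x y; first by rewrite !raddfD /=; ring.
      by rewrite !mderivM /=; ring.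
    + exact: derivation_mderiv.
    + by rewrite mulrC subrr.
    + by rewrite ju mulr0 subr0 rmorphM mulf_neq0.
  have w0 : w != 0.
    by apply/eqP => w0; apply: (@noprod 0 0); rewrite ?mulr0 ?rmorph0.
  have evw : ev w = 0.
    by rewrite rmorphD !rmorphXn /= -/ev [ev u]u0 [ev v]v0 !expr0n addr0.
  have [p [c [pP p0 def_w]]] := prime_factor_in_kernel (@factorial_mpoly k m) w0 evw.
  have cn0 : ev c != 0 by apply/negP => /eqP c0; exact: noprod def_w p0 c0.
  exists p; first exact: primer_irreducible.
  have gc : ~ dvdr g (msubst c f) by move/phiP/eqP; rewrite phi_msubst (negPf cn0).
  have msE x : msubst x f = meval (@mconst k n) F m x.
    by apply: msubst_meval => a; rewrite /F ext_ordE.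
  have [hu def_u] : dvdr g (msubst u f) by apply/phiP; rewrite phi_msubst.
  have [hv def_v] : dvdr g (msubst v f) by apply/phiP; rewrite phi_msubst.
  have [hp def_p] : dvdr g (msubst p f) by apply/phiP; rewrite phi_msubst.
  (* Cancel one [g] in [g * hp * c(f) = w(f) = g^2 (hu^2 + g * hv^3)]. Since [g] does not divide
     [c(f)], it divides [hp]. *)
  have : dvdr g (hp * msubst c f).
    exists (hu ^+ 2 + hv ^+ 3 * g); apply: (mulfI gn0).
    have := congr1 (fun x => msubst x f) def_w; rewrite /= !msE rmorphM -!msE.
    rewrite def_p => E; rewrite mulrA [g * hp]mulrC -E msE rmorphD !rmorphXn /= -!msE.
    by rewrite def_u def_v; ring.
  case/gM => // -[h def_h]; exists h.
  by rewrite def_p def_h expr2 mulrA.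
Qed.

End Jacobian.

(** * From prime divisors to the equivalences *)

Lemma nonunit_prime_divisor (k : fieldType) n (a : mpoly k n) : (0 < n)%N ->
  a \isn't a GRing.unit -> exists2 p, primer p & dvdr p a.
Proof.
move=> n0 aU; have [->|an0] := eqVneq a 0; last first.
  by apply: prime_divisor_exists => //; exact: factorial_mpoly.
(* Every prime divides 0; a prime factor of the last variable serves. *)
case: n n0 {a aU} => // n _.
have X0 : ('X : mpoly k n.+1) != 0 by rewrite polyX_eq0.
have XU : ('X : mpoly k n.+1) \isn't a GRing.unit by rewrite poly_unitE size_polyX.
have [p pP _] := prime_divisor_exists (@factorial_mpoly k n.+1) X0 XU.
by exists p => //; exact: dvdr0.
Qed.

Theorem theorem2p4 (k : fieldType) (Hchar : [pchar k] =i pred0)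
  (n m : nat) (Hm1 : (1 <= m)%N) (Hmn : (m <= n)%N)
  (f : 'I_m -> mpoly k n) (Hind : alg_indep f) :
  (dgcd_nonzero_const f <->
     (forall w : mpoly k m, irreducibler w -> squarefreer (msubst w f))) /\
  ((forall w : mpoly k m, irreducibler w -> squarefreer (msubst w f)) <->
     (forall w : mpoly k m, squarefreer w -> squarefreer (msubst w f))).
Proof.
have n0 : (0 < n)%N by exact: leq_trans Hm1 Hmn.
have irr_sqf (w : mpoly k m) : irreducibler w -> squarefreer w.
  move=> [_ [_ wI]] [b [c [def /negP bU]]]; apply: bU.
  move: def; rewrite expr2 -mulrA => /wI[//|].
  by rewrite unitrM => /andP[].
have i_iii : dgcd_nonzero_const f ->
    forall w : mpoly k m, squarefreer w -> squarefreer (msubst w f).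
  move=> [d [[_ dP] [c [c0 def_d]]]] w wS [b [e [def bU]]].
  have [g gP [x bx]] := nonunit_prime_divisor n0 bU.
  have [K [phi phiP]] := residue_field gP.
  (* The prime [g] divides all minors, hence their gcd [d], a nonzero constant. *)
  have /dP [y dy] : forall s, incr_idx s -> dvdr g (jac_minor f s).
    move=> s _; apply/phiP; apply: (square_dvdr_minors Hchar phiP wS).
    by exists (x ^+ 2 * e); rewrite def bx exprMn mulrAC.
  have [_ /negP gU _] := gP; apply: gU; apply: (@dvdr_unit _ _ d); first by exists y.
  by rewrite def_d rmorph_unit // unitfE.
have ii_i : (forall w : mpoly k m, irreducibler w -> squarefreer (msubst w f)) ->
    dgcd_nonzero_const f.
  (* To see that 1 is a gcd, take a prime factor [g] of a nonunit common divisor of the minors: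
     [g^2] would divide [w(f)] for some irreducible [w]. *)
  move=> H; exists 1; split; last by exists 1; rewrite oner_eq0 rmorph1.
  split=> [s _|d dP]; first by exists (jac_minor f s); rewrite mulr1.
  have [dU|dU] := boolP (d \is a GRing.unit); first by exists d^-1; rewrite mulVr.
  have [g gP gd] := nonunit_prime_divisor n0 dU.
  have [K [phi phiP]] := residue_field gP.
  have [|w wI [h def]] := @minors_dvdr_square k K n m f g phi Hchar phiP gP.
    by move=> s si; apply/phiP; apply: dvdr_trans gd _; exact: dP.
  case: (H w wI); exists g, h; rewrite def mulrC; split=> //.
  by have [_ gU _] := gP.
split; split=> [H w wI|H].
- by apply: i_iii => //; exact: irr_sqf.
- exact: ii_i.
- by apply: i_iii => //; exact: ii_i.
- by move=> w /irr_sqf; exact: H.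
Qed.
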